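(* Let $R$ be a unital ring with involution and let $a\in R$. Then $a$ is an EP element if and only if there exists $x\in R$ such that $(xa)^*=xa$, $xa^2=a$ and $ax^2=x$.
   Context: A unital (associative, not necessarily commutative) ring with involution is a unital ring $R$ with a map $a\mapsto a^*$ satisfying $(a^* )^*=a$, $(ab)^*=b^*a^*$, $(a+b)^*=a^*+b^*$ for all $a,b\in R$. The Moore-Penrose inverse of $a\in R$ is the element $a^\dagger=x$ (unique if it exists) with $axa=a$, $xax=x$, $(ax)^*=ax$, $(xa)^*=xa$; the group inverse of $a$ is the element $a^\#=x$ (unique if it exists) with $axa=a$, $xax=x$, $ax=xa$. An element $a\in R$ is EP if it is both Moore-Penrose invertible and group invertible and $a^\dagger=a^\#$. *)

(* Defs.v *)
From HB Require Import structures.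
From mathcomp Require Import all_boot all_algebra.

Set Implicit Arguments.
Unset Strict Implicit.
Unset Printing Implicit Defensive.

Import GRing.Theory.
Local Open Scope ring_scope.

(* [pzRingType] is the structure of unital associative rings, not necessarily
   commutative, in which 1 = 0 is not excluded. *)

(* The [>->] form of [{morph _}] makes the second law read
   star (a * b) = star b * star a. *)
Definition involution (R : pzRingType) (star : R -> R) : Prop :=
  [/\ involutive star,
      {morph star : a b / a * b >-> b * a}
    & {morph star : a b / a + b}].

Definition MP_inverse (R : pzRingType) (star : R -> R) (a x : R) : Prop :=
  [/\ a * x * a = a, x * a * x = x,
      star (a * x) = a * x & star (x * a) = x * a].

Definition group_inverse (R : pzRingType) (a x : R) : Prop :=
  [/\ a * x * a = a, x * a * x = x & a * x = x * a].

(* Naming the two inverses by existentially bound witnesses is legitimate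
   because each of them is unique: see the lemmas below. *)
Definition EP (R : pzRingType) (star : R -> R) (a : R) : Prop :=
  exists adag asharp : R,
    [/\ MP_inverse star a adag, group_inverse a asharp & adag = asharp].

Lemma MP_inverse_unique (R : pzRingType) (star : R -> R) (a x y : R) :
  involution star -> MP_inverse star a x -> MP_inverse star a y -> x = y.
Proof.
move=> [_ starM _] [axa xax sax sxa] [aya yay say sya].
have axay : a * x = a * y.
  by rewrite -sax -{1}aya -(mulrA (a * y)) starM sax say mulrA axa.
have xaya : x * a = y * a.
  by rewrite -sxa -{1}aya -!mulrA mulrA starM sya sxa -mulrA (mulrA a) axa.
by rewrite -xax xaya -mulrA axay mulrA yay.
Qed.

Lemma group_inverse_unique (R : pzRingType) (a x y : R) :
  group_inverse a x -> group_inverse a y -> x = y.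
Proof.
move=> [axa xax cx] [aya yay cy].
have axay : a * x = a * y.
  by rewrite -{1}aya -mulrA cx cy -mulrA (mulrA a) axa.
by rewrite -xax -cx axay cy -mulrA axay mulrA yay.
Qed.

(* Main.v *)
Require Import Defs.
From HB Require Import structures.
From mathcomp Require Import all_boot all_algebra.

Import GRing.Theory.
Local Open Scope ring_scope.

(** If [a] is EP, its common inverse serves as [x].  Conversely, the last two
    equations already make [x ^+ 2 * a] the group inverse of [a], by pure
    ring computation, and both of its products with [a] equal [x * a].  So the
    symmetry of [x * a] is all that is needed for this group inverse to be a
    Moore-Penrose inverse as well.  The inverse obtained need not be [x]
    itself: if [z = x * a * z] and [z * (x * a) = 0], then
    [x ^+ 2 * a + z] satisfies the same three equations. *)

(** Each product of [a] and [x ^+ 2 * a] contains [x * a ^+ 2] or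
    [a * x ^+ 2], hence collapses to [x * a].  This common value is a left
    identity for [a] and for [x ^+ 2 * a], which gives the remaining
    two equations. *)
Lemma group_inverse_sqr_mul (R : pzRingType) (a x : R) :
  x * a ^+ 2 = a -> a * x ^+ 2 = x ->
  group_inverse a (x ^+ 2 * a) /\ a * (x ^+ 2 * a) = x * a.
Proof.
move=> xaa axx.
have ay : a * (x ^+ 2 * a) = x * a by rewrite mulrA axx.
have ya : x ^+ 2 * a * a = x * a by rewrite -mulrA -expr2 expr2 -mulrA xaa.
split=> //; split; last by rewrite ay ya.
- by rewrite ay -mulrA -expr2.
- by rewrite ya -mulrA ay mulrA -expr2.
Qed.

Theorem theorem2p2 (R : pzRingType) (star : R -> R)
    (star_inv : involution star) (a : R) :
  EP star a <->
  exists x : R, [/\ star (x * a) = x * a, x * a ^+ 2 = a & a * x ^+ 2 = x].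
Proof.
split=> [[y [x [[_ _ _ sya] [axa xax cax] yx]]]|[x [sxa xaa axx]]].
  exists x; rewrite -{1 2}yx; split=> //; first by rewrite expr2 mulrA -cax.
  by rewrite expr2 mulrA cax.
have [gy ay] := group_inverse_sqr_mul _ _ _ xaa axx.
exists (x ^+ 2 * a), (x ^+ 2 * a); split=> //.
by have [aya yay cay] := gy; split; rewrite // -?cay ay.
Qed.
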